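(* Let $(M,\mathbf g)$ be a spacetime with time function $\tau$. If $\tau$ is anti-Lipschitz on $M$ with respect to a complete metric $d$ on $M$ that induces the manifold topology (that is, $p\le q\Rightarrow\tau(q)-\tau(p)\ge d(p,q)$ for all $p,q\in M$), then $(M,\hat d_\tau)$ is complete.
   Context: A spacetime $(M,\mathbf g)$ is a connected, time-oriented Lorentzian manifold (second countable, Hausdorff, signature $(-,+,\dots,+)$). We write $p\le q$ if $p=q$ or there is a future-directed causal curve from $p$ to $q$. A time function is a continuous function $\tau:M\to\mathbb R$ strictly increasing along future-directed causal curves. A piecewise causal curve is a continuous piecewise smooth curve $\beta:[a,b]\to M$ with a partition $a=s_0<\dots<s_k=b$ such that each piece is future-directed or past-directed causal. Its null length is $\hat L_\tau(\beta)=\sum_{i=1}^k|\tau(\beta(s_i))-\tau(\beta(s_{i-1}))|$; the null distance is $\hat d_\tau(p,q)=\inf\{\hat L_\tau(\beta):\beta\text{ a piecewise causal curve from }p\text{ to }q\}$. ''Metric'' for $d$ means distance function. *)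

(* Defs.v *)
From HB Require Import structures.
From mathcomp Require Import all_boot all_order all_algebra.
From mathcomp Require Import all_classical all_reals all_analysis.
Set Implicit Arguments.
Unset Strict Implicit.
Unset Printing Implicit Defensive.
Import Order.TTheory GRing.Theory Num.Theory.
Import numFieldNormedType.Exports.
Local Open Scope classical_set_scope.
Local Open Scope ring_scope.

(** * Smooth maps between normed spaces *)

(* [A] is meant to be open.  On finite-dimensional spaces, being C^(k+1) amounts
   to being continuous with directional derivatives that exist and are C^k. *)
Fixpoint Ck_on (R : realType) (V W : normedModType R) (k : nat) (A : set V)
    (f : V -> W) : Prop :=
  {in A, continuous f} /\
  if k is k'.+1 then
    forall v : V, {in A, forall x, derivable f x v} /\
                  Ck_on k' A (fun x => 'D_v f x)
  else True.

Definition smooth_on (R : realType) (V W : normedModType R) (A : set V)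
    (f : V -> W) : Prop :=
  forall k, Ck_on k A f.

Definition smooth_at (R : realType) (V W : normedModType R) (f : V -> W)
    (x : V) : Prop :=
  exists2 A : set V, open_nbhs x A & smooth_on A f.

(** * Smooth manifolds *)

(* A homeomorphism from the open set [cdom] of M onto an open set of R^m.  The
   maps are total; their values outside [cdom] and its image are irrelevant. *)
Record chart (R : realType) (m : nat) (M : topologicalType) := Chart {
  cdom : set M;
  cmap : M -> 'rV[R]_m;
  cinv : 'rV[R]_m -> M;
  cdom_open : open cdom;
  cimg_open : open (cmap @` cdom);
  cmapK : {in cdom, cancel cmap cinv};
  cmap_continuous : {in cdom, continuous cmap};
  cinv_continuous : {in cmap @` cdom, continuous cinv} }.

Definition cimg (R : realType) (m : nat) (M : topologicalType)
    (c : chart R m M) : set 'rV[R]_m :=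
  cmap c @` cdom c.

Definition transition (R : realType) (m : nat) (M : topologicalType)
    (c c' : chart R m M) : 'rV[R]_m -> 'rV[R]_m :=
  cmap c' \o cinv c.

Definition overlap (R : realType) (m : nat) (M : topologicalType)
    (c c' : chart R m M) : set 'rV[R]_m :=
  cmap c @` (cdom c `&` cdom c').

(* The atlas need not be maximal. *)
Definition smooth_atlas (R : realType) (m : nat) (M : topologicalType)
    (A : set (chart R m M)) : Prop :=
  (forall p, exists2 c, A c & cdom c p) /\
  (forall c c', A c -> A c' -> smooth_on (overlap c c') (transition c c')).

(** * Lorentzian metrics and time orientations, in the charts of an atlas *)

Definition bilin (R : realType) (m : nat) (G : 'M[R]_m) (u v : 'rV[R]_m) : R :=
  (u *m G *m v^T) 0 0.

(* In some basis (the rows of P), the form is diag(-1, 1, ..., 1). *)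
Definition lorentz_signature (R : realType) (n : nat) (G : 'M[R]_n.+1) : Prop :=
  exists2 P : 'M[R]_n.+1, P \in unitmx &
    P *m G *m P^T = diag_mx (\row_j (if j == ord0 then -1 else 1)).

(* [g c x] is the matrix of the metric at the point with coordinates x in the
   chart c.  The tangent map of a change of charts at x is u |-> 'D_u _ x. *)
Definition lorentzian_metric (R : realType) (n : nat) (M : topologicalType)
    (A : set (chart R n.+1 M))
    (g : chart R n.+1 M -> 'rV[R]_n.+1 -> 'M[R]_n.+1) : Prop :=
  [/\ forall c, A c -> smooth_on (cimg c) (g c),
      forall c x, A c -> cimg c x ->
        (g c x)^T = g c x /\ lorentz_signature (g c x) &
      forall c c' x u v, A c -> A c' -> overlap c c' x ->
        bilin (g c x) u v =
        bilin (g c' (transition c c' x))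
          ('D_u (transition c c') x) ('D_v (transition c c') x)].

(* A continuous timelike vector field, given by its components in charts. *)
Definition time_orientation (R : realType) (n : nat) (M : topologicalType)
    (A : set (chart R n.+1 M))
    (g : chart R n.+1 M -> 'rV[R]_n.+1 -> 'M[R]_n.+1)
    (T : chart R n.+1 M -> 'rV[R]_n.+1 -> 'rV[R]_n.+1) : Prop :=
  [/\ forall c, A c -> {in cimg c, continuous (T c)},
      forall c x, A c -> cimg c x -> bilin (g c x) (T c x) (T c x) < 0 &
      forall c c' x, A c -> A c' -> overlap c c' x ->
        T c' (transition c c' x) = 'D_(T c x) (transition c c') x].

Record spacetime (R : realType) (n : nat) (M : topologicalType) := Spacetime {
  atlas : set (chart R n.+1 M);
  metric : chart R n.+1 M -> 'rV[R]_n.+1 -> 'M[R]_n.+1;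
  timefield : chart R n.+1 M -> 'rV[R]_n.+1 -> 'rV[R]_n.+1;
  st_hausdorff : hausdorff_space M;
  st_second_countable : @second_countable M;
  st_connected : connected [set: M];
  st_atlas : smooth_atlas atlas;
  st_metric : lorentzian_metric atlas metric;
  st_orientation : time_orientation atlas metric timefield }.

(** * Causal curves *)

Section Causality.
Variables (R : realType) (n : nat) (M : topologicalType).
Variable S : spacetime R n M.

Definition causal_vec (c : chart R n.+1 M) (x v : 'rV[R]_n.+1) : Prop :=
  v != 0 /\ bilin (metric S c x) v v <= 0.

Definition future_vec (c : chart R n.+1 M) (x v : 'rV[R]_n.+1) : Prop :=
  causal_vec c x v /\ bilin (metric S c x) (timefield S c x) v < 0.

Definition past_vec (c : chart R n.+1 M) (x v : 'rV[R]_n.+1) : Prop :=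
  causal_vec c x v /\ 0 < bilin (metric S c x) (timefield S c x) v.

(* The restriction of gamma to [a, b] is smooth (it extends smoothly beyond the
   end points) and its velocities satisfy C. *)
Definition smooth_curve_with
    (C : chart R n.+1 M -> 'rV[R]_n.+1 -> 'rV[R]_n.+1 -> Prop)
    (gamma : R -> M) (a b : R) : Prop :=
  exists2 delta : R -> M, {in `[a, b], gamma =1 delta} &
    forall t c, t \in `[a, b] -> atlas S c -> cdom c (delta t) ->
      [/\ \forall s \near t, cdom c (delta s),
          smooth_at (cmap c \o delta) t &
          C c (cmap c (delta t)) (derive1 (cmap c \o delta) t)].

(* Piecewise smooth version; the pieces are closed intervals, so that gamma is
   continuous on [a, b]. *)
Definition pw_smooth_curve_with
    (C : chart R n.+1 M -> 'rV[R]_n.+1 -> 'rV[R]_n.+1 -> Prop)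
    (gamma : R -> M) (a b : R) : Prop :=
  a < b /\
  exists2 s : seq R, itv_partition a b s &
    forall i, (i < size s)%N ->
      smooth_curve_with C gamma (nth b (a :: s) i) (nth b (a :: s) i.+1).

Definition future_causal_curve := pw_smooth_curve_with future_vec.

Definition past_causal_curve := pw_smooth_curve_with past_vec.

Definition causal_le (p q : M) : Prop :=
  p = q \/
  exists (gamma : R -> M) (a b : R),
    [/\ future_causal_curve gamma a b, gamma a = p & gamma b = q].

Definition time_function (tau : M -> R) : Prop :=
  continuous tau /\
  forall (gamma : R -> M) (a b : R), future_causal_curve gamma a b ->
    {in `[a, b] &, {homo tau \o gamma : s t / s < t}}.

(* [a :: s] lists the points of the partition of [a, b]. *)
Definition piecewise_causal_curve (beta : R -> M) (a b : R) (s : seq R) : Prop :=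
  [/\ a < b, itv_partition a b s, {within `[a, b], continuous beta} &
      forall i, (i < size s)%N ->
        future_causal_curve beta (nth b (a :: s) i) (nth b (a :: s) i.+1) \/
        past_causal_curve beta (nth b (a :: s) i) (nth b (a :: s) i.+1)].

Definition null_length (tau : M -> R) (beta : R -> M) (a b : R) (s : seq R) : R :=
  variation a b (tau \o beta) s.

(* The set is bounded below by 0, and it is nonempty because M is connected, so
   the conventional value 0 of [inf] on the empty set plays no role. *)
Definition null_distance (tau : M -> R) (p q : M) : R :=
  inf [set l | exists (beta : R -> M) (a b : R) (s : seq R),
    [/\ piecewise_causal_curve beta a b s, beta a = p, beta b = q &
        l = null_length tau beta a b s]].

Definition anti_lipschitz (tau : M -> R) (d : M -> M -> R) : Prop :=
  forall p q, causal_le p q -> d p q <= tau q - tau p.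

End Causality.

(** * Distance functions *)

Definition is_metric (R : realType) (M : Type) (d : M -> M -> R) : Prop :=
  [/\ forall p q, 0 <= d p q,
      forall p q, d p q = 0 <-> p = q,
      forall p q, d p q = d q p &
      forall p q r, d p r <= d p q + d q r].

Definition complete_metric (R : realType) (M : Type) (d : M -> M -> R) : Prop :=
  is_metric d /\
  forall u : nat -> M,
    (forall e : R, 0 < e -> exists N, forall i j,
       (N <= i)%N -> (N <= j)%N -> d (u i) (u j) < e) ->
    exists p, forall e : R, 0 < e -> exists N, forall i,
       (N <= i)%N -> d (u i) p < e.

Definition induces_topology (R : realType) (M : topologicalType)
    (d : M -> M -> R) : Prop :=
  forall (p : M) (A : set M),
    nbhs p A <-> exists2 e : R, 0 < e & [set q | d p q < e] `<=` A.

(* Main.v *)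
Require Import Defs.
From HB Require Import structures.
From mathcomp Require Import all_boot all_order all_algebra.
From mathcomp Require Import all_classical all_reals all_analysis.
From mathcomp Require Import ring lra.

(* Along a causal curve |tau(q) - tau(p)| >= d(p, q), so by the triangle
   inequality d <= null distance.  Conversely the null distance is continuous:
   if q is close to p, then in a chart the straight line from p along the time
   orientation and the straight line from q to the end point of the former are
   both future timelike, and tau varies little along them.  Hence a Cauchy
   sequence for the null distance is Cauchy for d, so converges in M, so
   converges for the null distance.  The same pairs of lines and connectedness
   show that any two points are joined by a piecewise causal curve. *)

Set Implicit Arguments.
Unset Strict Implicit.
Unset Printing Implicit Defensive.
Import Order.TTheory GRing.Theory Num.Theory.
Import numFieldNormedType.Exports.
Local Open Scope classical_set_scope.
Local Open Scope ring_scope.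

(** * Precomposition of smooth maps with affine maps *)

Section AffineChange.
Variables (R : realType) (V W U : normedModType R) (phi L : V -> W).
Hypothesis phiE : forall (h : R) x v, phi (h *: v + x) = h *: L v + phi x.
Hypothesis phi_continuous : continuous phi.

(** The quotients agree as functions of [h], before any limit is taken, so derivability and the
    value of the derivative transfer together. *)
Lemma difference_quotient_comp_affine (f : W -> U) x v :
  (fun h : R => h^-1 *: (((f \o phi) \o shift x) (h *: v) - (f \o phi) x)) =
  (fun h => h^-1 *: ((f \o shift (phi x)) (h *: L v) - f (phi x))).
Proof. by apply/funext => h /=; rewrite phiE. Qed.

Lemma derive_comp_affine (f : W -> U) x v :
  'D_v (f \o phi) x = 'D_(L v) f (phi x).
Proof. by rewrite /derive difference_quotient_comp_affine. Qed.

Lemma derivable_comp_affine (f : W -> U) x v :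
  derivable f (phi x) (L v) -> derivable (f \o phi) x v.
Proof. by rewrite /derivable difference_quotient_comp_affine. Qed.

(** The derivative of [f \o phi] along [v] is ['D_(L v) f] composed with [phi], again a map of the
    same shape; hence induction on [k] for all [f] at once. *)
Lemma Ck_on_comp_affine k A (f : W -> U) :
  Ck_on k A f -> Ck_on k (phi @^-1` A) (f \o phi).
Proof.
elim: k A f => [|k IH] A f /= [fC fD].
  split=> // x; rewrite inE /= => Ax.
  apply: continuous_comp; first exact: phi_continuous.
  by apply: fC; rewrite inE.
split=> [x|v].
  rewrite inE /= => Ax; apply: continuous_comp; first exact: phi_continuous.
  by apply: fC; rewrite inE.
have [fD1 fD2] := fD (L v); split.
  move=> x; rewrite inE /= => Ax.
  by apply: derivable_comp_affine; apply: fD1; rewrite inE.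
rewrite (_ : (fun x => _) = (fun x => 'D_(L v) f x) \o phi); first exact: IH.
by apply/funext => x; exact: derive_comp_affine.
Qed.

Lemma smooth_at_comp_affine (f : W -> U) x :
  smooth_at f (phi x) -> smooth_at (f \o phi) x.
Proof.
move=> [A [Ao Ax] fA]; exists (phi @^-1` A); first split=> //.
  by apply: open_comp => // y _; exact: phi_continuous.
by move=> k; exact/Ck_on_comp_affine/fA.
Qed.

End AffineChange.

Lemma smooth_at_derivable (R : realType) (V W : normedModType R) (f : V -> W)
    x v :
  smooth_at f x -> derivable f x v.
Proof.
by move=> [A [_ Ax] /(_ 1%N)[_ /(_ v)[fD _]]]; apply: fD; rewrite inE.
Qed.

Lemma smooth_at_continuous (R : realType) (V W : normedModType R) (f : V -> W)
    x :
  smooth_at f x -> {for x, continuous f}.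
Proof. by move=> [A [_ Ax] /(_ 0%N)[fC _]]; apply: fC; rewrite inE. Qed.

(** * Affine reparametrizations of the real line *)

Section Reparam.
Variables (R : realType) (e k : R).
Let phi (t : R) := e * t + k.

Lemma scale_shiftE (h x v : R) : phi (h *: v + x) = h *: (e * v) + phi x.
Proof. by rewrite /phi /GRing.scale /= mulrDr addrA mulrCA. Qed.

Lemma scale_shift_continuous : continuous phi.
Proof.
move=> t; apply: cvgD; last exact: cvg_cst.
by apply: cvgM; [exact: cvg_cst|exact: cvg_id].
Qed.

Lemma derive1_scale_shift (V : normedModType R) (f : R -> V) t :
  derivable f (phi t) 1 -> derive1 (f \o phi) t = e *: derive1 f (phi t).
Proof.
move=> fD; rewrite derive1E (derive_comp_affine scale_shiftE) mulr1.
have fd : differentiable f (phi t) by apply/derivable1_diffP.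
rewrite deriveE// deriv1E//.
Qed.

End Reparam.

(** * Bilinearity and continuity of the form given by a matrix *)

Section Bilin.
Variables (R : realType) (m : nat).
Implicit Types (G : 'M[R]_m) (u v : 'rV[R]_m).

Lemma bilinZl G a u v : bilin G (a *: u) v = a * bilin G u v.
Proof. by rewrite /bilin -!scalemxAl mxE. Qed.

Lemma bilinZr G a u v : bilin G u (a *: v) = a * bilin G u v.
Proof. by rewrite /bilin linearZ /= -scalemxAr mxE. Qed.

Lemma bilin0r G u : bilin G u 0 = 0.
Proof. by rewrite -(scale0r 0) bilinZr mul0r. Qed.

(** The form is a finite sum of products of entries, each of which converges. This makes being
    future timelike an open condition on the pair of point and vector. *)
Lemma cvg_bilin (T : Type) (F : set_system T) {FF : Filter F}
    (G_ : T -> 'M[R]_m) (u_ v_ : T -> 'rV[R]_m) G u v :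
  G_ @ F --> G -> u_ @ F --> u -> v_ @ F --> v ->
  (fun t => bilin (G_ t) (u_ t) (v_ t)) @ F --> bilin G u v.
Proof.
move=> cG cu cv.
have coord k l (A_ : T -> 'M[R]_(k, l)) (A : 'M[R]_(k, l)) i j :
    A_ @ F --> A -> (fun t => A_ t i j) @ F --> A i j.
  apply: (@continuous_cvg _ _ _ _ _ _ (fun B : 'M[R]_(k, l) => B i j)).
  exact: coord_continuous.
rewrite /bilin mxE.
under [X in X @ F]eq_fun do rewrite mxE.
apply: cvg_big => [|j _]; first exact: add_continuous.
rewrite !mxE; under eq_fun do rewrite !mxE.
apply: cvgM; last exact: coord.
apply: cvg_big => [|i _]; first exact: add_continuous.
by apply: cvgM; exact: coord.
Qed.

End Bilin.

(** * Smooth causal curves: translation, reversal, straight lines in charts *)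

Section Segments.
Variables (R : realType) (n : nat) (M : topologicalType).
Variable S : spacetime R n M.
Implicit Types (C : chart R n.+1 M -> 'rV[R]_n.+1 -> 'rV[R]_n.+1 -> Prop).
Implicit Types (gamma : R -> M) (p q r : M).

Lemma past_vecN c x v : past_vec S c x v -> future_vec S c x (- v).
Proof.
move=> [[v0 vv] Tv]; rewrite -scaleN1r; split; last first.
  by rewrite bilinZr mulN1r oppr_lt0.
split; first by rewrite scaler_eq0 oppr_eq0 oner_eq0.
by rewrite bilinZr bilinZl !mulN1r opprK.
Qed.

Lemma future_vecN c x v : future_vec S c x v -> past_vec S c x (- v).
Proof.
move=> [[v0 vv] Tv]; rewrite -scaleN1r; split; last first.
  by rewrite bilinZr mulN1r oppr_gt0.
split; first by rewrite scaler_eq0 oppr_eq0 oner_eq0.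
by rewrite bilinZr bilinZl !mulN1r opprK.
Qed.

Lemma eq_smooth_curve C gamma gamma' a b : {in `[a, b], gamma' =1 gamma} ->
  smooth_curve_with S C gamma a b -> smooth_curve_with S C gamma' a b.
Proof.
by move=> e [delta ed H]; exists delta => // t tab; rewrite e// ed.
Qed.

Lemma smooth_curve_scale_shift C C' gamma e k a b a' b' :
  (forall c x v, C c x v -> C' c x (e *: v)) ->
  (forall t, t \in `[a', b'] -> e * t + k \in `[a, b]) ->
  smooth_curve_with S C gamma a b ->
  smooth_curve_with S C' (fun t => gamma (e * t + k)) a' b'.
Proof.
move=> CC' ab' [delta ed H]; exists (fun t => delta (e * t + k)).
  by move=> t /ab'/ed ->.
move=> t c /ab' tab Sc ct; have [nc sm Ct] := H _ _ tab Sc ct.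
split; first exact: (scale_shift_continuous nc).
- exact: (smooth_at_comp_affine (scale_shiftE e k)
    (@scale_shift_continuous _ e k) (f := cmap c \o delta)).
- rewrite (derive1_scale_shift (f := cmap c \o delta)); first exact: CC'.
  exact: smooth_at_derivable.
Qed.

Lemma smooth_curve_pw C gamma a b : a < b ->
  smooth_curve_with S C gamma a b -> pw_smooth_curve_with S C gamma a b.
Proof.
move=> ab H; split=> //; exists [:: b]; first exact: itv_partition1.
by case.
Qed.

(** Smoothness speaks only of coordinates; continuity in M comes back through the continuous inverse
    of a chart. *)
Lemma smooth_curve_continuous C gamma a b :
  smooth_curve_with S C gamma a b -> {within `[a, b], continuous gamma}.
Proof.
move=> [delta ed H].
apply: (@subspace_eq_continuous _ _ _ (delta : subspace `[a, b] -> M)).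
  by move=> t; rewrite inE => /ed /esym.
rewrite continuous_subspace_in => t; rewrite inE /= => tab.
apply: continuous_subspaceT_for => //.
have [c Sc ct] := (st_atlas S).1 (delta t).
have [nc sm _] := H _ _ tab Sc ct.
(* Near [t] the curve stays in the domain of [c], so there it equals this composite. *)
have : (cinv c \o (cmap c \o delta)) s @[s --> t] --> delta t.
  rewrite -[X in _ --> X](cmapK (c := c)) ?inE//.
  apply: (@continuous_comp _ _ _ (cmap c \o delta) (cinv c) t).
    exact: smooth_at_continuous.
  by apply: cinv_continuous; rewrite inE; exists (delta t).
apply: cvg_trans; apply: near_eq_cvg; near=> s => /=.
by rewrite cmapK// inE; near: s.
Unshelve. all: by end_near. Qed.

(** A single smooth piece with its parameter interval forgotten: chains below record end points
    only. *)
Definition future_segment p q := exists (gamma : R -> M) a b,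
  [/\ a < b, smooth_curve_with S (future_vec S) gamma a b,
      gamma a = p & gamma b = q].

(** The free starting parameter [t] lets a segment be attached where another curve ends. *)
Lemma future_segment_curve p q t : future_segment p q ->
  exists gamma u, [/\ t < u, smooth_curve_with S (future_vec S) gamma t u,
                      gamma t = p & gamma u = q].
Proof.
move=> [gamma [a [b [ab sm <- <-]]]].
exists (fun s => gamma (1 * s + (a - t))), (b - a + t); split.
- by rewrite ltrDr subr_gt0.
- apply: smooth_curve_scale_shift sm; first by move=> *; rewrite scale1r.
  by move=> s; rewrite !in_itv /= => /andP[? ?]; apply/andP; split; lra.
- by congr gamma; ring.
- by congr gamma; ring.
Qed.

Lemma future_segment_past_curve p q t : future_segment p q ->
  exists gamma u, [/\ t < u, smooth_curve_with S (past_vec S) gamma t u,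
                      gamma t = q & gamma u = p].
Proof.
move=> [gamma [a [b [ab sm <- <-]]]].
exists (fun s => gamma (-1 * s + (b + t))), (b - a + t); split.
- by rewrite ltrDr subr_gt0.
- apply: smooth_curve_scale_shift sm.
    by move=> *; rewrite scaleN1r; exact: future_vecN.
  by move=> s; rewrite !in_itv /= => /andP[? ?]; apply/andP; split; lra.
- by congr gamma; ring.
- by congr gamma; ring.
Qed.

Lemma past_curve_future_segment gamma a b : a < b ->
  smooth_curve_with S (past_vec S) gamma a b ->
  future_segment (gamma b) (gamma a).
Proof.
move=> ab sm; exists (fun s => gamma (-1 * s + (a + b))), a, b; split=> //.
- apply: smooth_curve_scale_shift sm.
    by move=> *; rewrite scaleN1r; exact: past_vecN.
  by move=> s; rewrite !in_itv /= => /andP[? ?]; apply/andP; split; lra.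
- by congr gamma; ring.
- by congr gamma; ring.
Qed.

Lemma future_segment_le p q : future_segment p q -> causal_le S p q.
Proof.
move=> [gamma [a [b [ab sm pE qE]]]]; right; exists gamma, a, b; split=> //.
exact: smooth_curve_pw.
Qed.

(** [cinv c] is known to be continuous only at points of [cimg c], so the preimage of [cdom c'] is
    shown open point by point inside that open set. *)
Lemma open_overlap (c c' : chart R n.+1 M) : open (overlap c c').
Proof.
have -> : overlap c c' = cimg c `&` cinv c @^-1` (cdom c').
  apply/seteqP; split=> [_ [p [cp c'p] <-]|x [[p cp <-]]].
    by split; [exists p|rewrite /= cmapK// inE].
  by rewrite /= cmapK ?inE// => c'p; exists p.
rewrite openE => x [cx c'x]; rewrite /interior.
apply: filterI; first by apply: open_nbhs_nbhs; split; [exact: cimg_open|].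
have cc : {for x, continuous (cinv c)}.
  by apply: cinv_continuous; rewrite inE.
by apply: cc; apply: open_nbhs_nbhs; split; [exact: cdom_open|].
Qed.

(** The sign conditions are checked in the one chart [c]; the transformation laws of the metric and
    of the time field carry them to every other chart. *)
Lemma line_future_segment c x v s : atlas S c -> 0 < s ->
  (forall t, t \in `[0, s] -> let y := x + t *: v in
    [/\ cimg c y, bilin (metric S c y) v v < 0 &
        bilin (metric S c y) (timefield S c y) v < 0]) ->
  future_segment (cinv c x) (cinv c (x + s *: v)).
Proof.
move=> Sc s0 H; exists (fun t => cinv c (x + t *: v)), 0, s.
split=> //; last by rewrite scale0r addr0.
have phiE (h t w : R) : x + (h *: w + t) *: v = h *: (w *: v) + (x + t *: v).
  by rewrite scalerDl scalerA addrCA.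
have phiC : continuous (fun t : R => x + t *: v).
  move=> t; apply: cvgD; first exact: cvg_cst.
  by apply: cvgZr_tmp; exact: cvg_id.
(* In another chart [c'] the line reads as the transition map after an affine map, so the lemmas on
   affine precomposition apply. *)
exists (fun t => cinv c (x + t *: v)) => // t c' /H[cy vv Tv] Sc' c't.
have oy : overlap c c' (x + t *: v).
  case: cy c't => p cp <-; rewrite cmapK ?inE// => c'p.
  by exists p.
have sm : smooth_at (transition c c') (x + t *: v).
  exists (overlap c c'); first by split; [exact: open_overlap|].
  exact: (st_atlas S).2.
have [_ _ gE] := st_metric S; have [_ _ TE] := st_orientation S.
split.
- have : \forall y \near x + t *: v, cdom c' (cinv c y).
    have cc : {for x + t *: v, continuous (cinv c)}.
      by apply: cinv_continuous; rewrite inE.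
    by apply: cc; apply: open_nbhs_nbhs; split; [exact: cdom_open|].
  exact: phiC.
- exact: (smooth_at_comp_affine phiE phiC (f := transition c c')).
- rewrite derive1E (derive_comp_affine phiE (transition c c')) scale1r.
  rewrite /future_vec /causal_vec -/(transition c c' _).
  rewrite [cmap c' _](_ : _ = transition c c' (x + t *: v))//.
  rewrite TE// -!gE//; split=> //; split; last exact: ltW.
  (* If the velocity vanished in [c'], invariance of the metric would give [v] the value 0 in [c],
     but that value is negative. *)
  apply: contraTneq vv => Dv0.
  by rewrite (gE c c')// Dv0 bilin0r ltxx.
Qed.

End Segments.

(** * Chains of causal segments and their existence *)

Section Chains.
Variables (R : realType) (n : nat) (M : topologicalType).
Variables (S : spacetime R n M) (tau : M -> R).
Implicit Types p q r : M.

Definition causal_step p q := future_segment S p q \/ future_segment S q p.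

(** Discrete stand-in for a piecewise causal curve: only break points are kept, and the real index
    is the null length. Concatenation and reversal then involve no parameters. *)
Inductive causal_chain p : M -> R -> Prop :=
| causal_chain1 q : causal_step p q -> causal_chain p q `|tau q - tau p|
| causal_chain_rcons q r l : causal_chain p q l -> causal_step q r ->
    causal_chain p r (l + `|tau r - tau q|).

Lemma causal_chain_cat p q r l l' :
  causal_chain p q l -> causal_chain q r l' -> causal_chain p r (l + l').
Proof.
move=> pq; elim=> {r l'} [r qr|r r' l' _ IH rr']; first exact: causal_chain_rcons.
by rewrite addrA; exact: causal_chain_rcons IH rr'.
Qed.

Lemma causal_chain_sym p q l : causal_chain p q l -> causal_chain q p l.
Proof.
have step_sym p' q' : causal_step p' q' -> causal_step q' p'.
  by case; [right|left].
elim=> {q l} [q /step_sym|q r l _ IH /step_sym rq].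
  by rewrite distrC; exact: causal_chain1.
rewrite addrC distrC; apply: causal_chain_cat IH; exact: causal_chain1.
Qed.

(** The bound is [k.+1] because a chain has at least one step. *)
Lemma causal_chain_sum (x : nat -> M) k :
  (forall i, (i < k.+1)%N ->
    causal_chain (x i) (x i.+1) `|tau (x i.+1) - tau (x i)|) ->
  causal_chain (x 0%N) (x k.+1)
    (\sum_(0 <= i < k.+1) `|tau (x i.+1) - tau (x i)|).
Proof.
elim: k => [|k IH] H; first by rewrite big_nat1; exact: H.
rewrite big_nat_recr//=; apply: causal_chain_cat; last exact: H.
by apply: IH => i ik; apply: H; exact: ltnW.
Qed.

(** The chain has two steps, up from [p] to a point [z] and down from [z] to [q]. Both lines are
    future timelike because the sign conditions are open at the pair of [p] and its time
    direction. *)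
Lemma near_causal_chain p e : continuous tau -> 0 < e ->
  \forall q \near p, exists2 l, l < e & causal_chain p q l.
Proof.
move=> tauC e0.
have [c Sc cp] := (st_atlas S).1 p.
have [gC _ _] := st_metric S; have [TC Tneg _] := st_orientation S.
pose x0 := cmap c p; pose T0 := timefield S c x0.
have x0p : cinv c x0 = p by rewrite /x0 cmapK ?inE.
have cx0 : cimg c x0 by exists p.
have cg : metric S c z.1 @[z --> (x0, T0)] --> metric S c x0.
  apply: cvg_comp; first exact: cvg_fst.
  by apply: (gC c Sc 0%N).1; rewrite inE.
have cT : timefield S c z.1 @[z --> (x0, T0)] --> T0.
  apply: cvg_comp; first exact: cvg_fst.
  by apply: (TC c Sc); rewrite inE.
have cv : z.2 @[z --> (x0, T0)] --> T0 by exact: cvg_snd.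
have T00 : bilin (metric S c x0) T0 T0 < 0 by exact: Tneg.
(* Taken jointly in point and vector, the conditions yield one radius [r] that serves every base
   point and velocity used below. *)
have : \forall z \near (x0, T0),
    [/\ cimg c z.1, bilin (metric S c z.1) z.2 z.2 < 0,
        bilin (metric S c z.1) (timefield S c z.1) z.2 < 0 &
        `|tau p - tau (cinv c z.1)| < e / 4].
  have n1 : \forall z \near (x0, T0), cimg c z.1.
    apply: (@cvg_fst _ _ (nbhs x0) (nbhs T0)).
    by apply: open_nbhs_nbhs; split; [exact: cimg_open|].
  have n2 := cvgr_lt _ (cvg_bilin cg cv cv) _ T00.
  have n3 := cvgr_lt _ (cvg_bilin cg cT cv) _ T00.
  have n4 : \forall z \near (x0, T0), `|tau p - tau (cinv c z.1)| < e / 4.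
    have tc : tau (cinv c z.1) @[z --> (x0, T0)] --> tau p.
      have : tau (cinv c x) @[x --> x0] --> tau p.
        rewrite -x0p.
        apply: (@continuous_comp _ _ _ (cinv c) tau x0); last exact: tauC.
        by apply: cinv_continuous; rewrite inE.
      by apply: cvg_comp; exact: cvg_fst.
    move/cvgrPdist_lt : tc; apply; lra.
  near=> z; split; near: z; [exact: n1|exact: n2|exact: n3|exact: n4].
move=> /nbhs_ballP[r /= r0 br].
have {}br x v : `|x0 - x| < r -> `|T0 - v| < r ->
    [/\ cimg c x, bilin (metric S c x) v v < 0,
        bilin (metric S c x) (timefield S c x) v < 0 &
        `|tau p - tau (cinv c x)| < e / 4].
  by move=> xr vr; apply: (br (x, v)); split; rewrite /= -ball_normE.
(* [s] and [del] keep both legs, [x0] to [x0 + s T0] and [x1] to [x0 + s T0],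
   in the [r]-ball about [x0], with velocities [r]-close to [T0]. *)
pose s := r / 2 / (1 + `|T0|).
have T1 : 0 < 1 + `|T0| by rewrite ltr_wpDr.
have s0 : 0 < s by rewrite /s !divr_gt0.
have sT : s * `|T0| < r / 2.
  rewrite /s mulrAC ltr_pdivrMr// ltr_pM2l ?divr_gt0//; lra.
have nT t : t \in `[0, s] -> `|t *: T0| < r / 2.
  rewrite in_itv /= => /andP[t0 ts]; rewrite normrZ ger0_norm//.
  by apply: le_lt_trans sT; rewrite ler_wpM2r.
pose z := cinv c (x0 + s *: T0).
have zT : `|tau p - tau z| < e / 4.
  have [] // := br (x0 + s *: T0) T0 _ _.
  - rewrite opprD addNKr normrN (lt_trans (nT s _))//; last lra.
    by rewrite in_itv /= lexx ltW.
  - by rewrite subrr normr0.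
have pz : future_segment S p z.
  rewrite -x0p; apply: line_future_segment => // t ts y.
  have [] // := br y T0 _ _; last by rewrite subrr normr0.
  rewrite opprD addNKr normrN (lt_trans (nT t _))//; lra.
pose del := Num.min (r / 2) (r * s).
have del0 : 0 < del by rewrite lt_min divr_gt0//= mulr_gt0.
have n1 : \forall q \near p, `|x0 - cmap c q| < del.
  have : cmap c q @[q --> p] --> x0 by apply: cmap_continuous; rewrite inE.
  by move/cvgrPdist_lt; exact.
have n2 : \forall q \near p, cdom c q.
  by apply: open_nbhs_nbhs; split; [exact: cdom_open|].
near=> q.
have cq : cdom c q by near: q.
have : `|x0 - cmap c q| < del by near: q.
set x1 := cmap c q; rewrite lt_min => /andP[x1r x1s].
have x1q : cinv c x1 = q by rewrite /x1 cmapK ?inE.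
(* The velocity that leads from [x1] to [x0 + s *: T0] in time [s]; it differs from [T0] by less
   than [r] since [x1] is within [r * s] of [x0]. *)
pose v := T0 - s^-1 *: (x1 - x0).
have vT : `|T0 - v| < r.
  rewrite /v opprB addrC subrK normrZ distrC gtr0_norm ?invr_gt0//.
  by rewrite mulrC ltr_pdivrMr.
have qz : future_segment S q z.
  rewrite -x1q /z (_ : x0 + s *: T0 = x1 + s *: v); last first.
    rewrite /v scalerBr scalerA divff ?gt_eqF// scale1r.
    by rewrite addrCA opprB subrKC addrC.
  apply: line_future_segment => // t ts y.
  have [] // := br y v _ _.
  (* The factor [1 - t / s] lies in [0, 1], so each of the two terms has norm below [r / 2]. *)
  have -> : x0 - y = (1 - t / s) *: (x0 - x1) - t *: T0.
    by apply/rowP => j; rewrite !mxE; ring.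
  rewrite (le_lt_trans (ler_normB _ _))// [ltRHS]splitr ler_ltD ?nT//.
  rewrite normrZ; apply: le_trans (ltW x1r); rewrite ler_piMl//.
  move: ts; rewrite in_itv /= => /andP[t0 ts].
  have ts0 : 0 <= t / s by rewrite divr_ge0// ltW.
  have ts1 : t / s <= 1 by rewrite ler_pdivrMr ?mul1r.
  by rewrite ger0_norm; lra.
(* The first term is below [e / 4]; the second, compared through [tau p], is below twice that. The
   total stays under [e]. *)
exists (`|tau z - tau p| + `|tau q - tau z|); last first.
  by apply: causal_chain_rcons; [apply: causal_chain1; left|right].
have [||_ _ _ qT] := br x1 T0; [lra|by rewrite subrr normr0|].
move: qT; rewrite x1q => qT.
rewrite [`|tau z - _|]distrC [`|tau q - _|]distrC.
have : `|tau z - tau q| <= `|tau p - tau z| + `|tau p - tau q|.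
  by rewrite [`|tau p - tau z|]distrC ler_distD.
lra.
Unshelve. all: by end_near. Qed.

(** The set of points reached from [p] is nonempty, open and closed in the connected space M. *)
Lemma causal_chain_total p q : continuous tau -> exists l, causal_chain p q l.
Proof.
move=> tauC.
pose B := [set r | exists l, causal_chain p r l].
have nearB r : \forall r' \near r, exists l, causal_chain r r' l.
  apply: filterS (near_causal_chain r tauC ltr01) => r' [l _ ?]; by exists l.
suff BT : B = setT by rewrite -[exists l, _]/(B q) BT.
apply: (st_connected S).
- by exists p; exact: nbhs_singleton (nearB p).
- exists B; rewrite ?setTI// openE => r [l pr]; rewrite /interior.
  apply: filterS (nearB r) => r' [l' rr']; exists (l + l').
  exact: causal_chain_cat rr'.
(* Closedness: a point [r] of the closure has a short chain to some reached point, and that chain is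
   run backwards. *)
- exists B; rewrite ?setTI// => r /(_ _ (nearB r))[r' [[l pr'] [l' rr']]].
  by exists (l + l'); exact: causal_chain_cat (causal_chain_sym rr').
Qed.

End Chains.

(** * The null distance as an infimum over causal chains *)

Lemma sum_dist_nondecreasing (R : realType) (f : nat -> R) k :
  (forall i, (i < k)%N -> f i <= f i.+1) ->
  \sum_(0 <= i < k) `|f i.+1 - f i| = `|f k - f 0%N|.
Proof.
move=> H; rewrite (eq_big_nat _ _ (F2 := fun i => f i.+1 - f i)); last first.
  by move=> i /andP[_ ik]; rewrite ger0_norm// subr_ge0 H.
rewrite telescope_sumr// ger0_norm// -telescope_sumr// big_nat.
by apply: sumr_ge0 => i /andP[_ ik]; rewrite subr_ge0 H.
Qed.

Section NullDistance.
Variables (R : realType) (n : nat) (M : topologicalType).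
Variables (S : spacetime R n M) (tau : M -> R).
Implicit Types (p q r : M) (beta gamma : R -> M).
Implicit Types (C : chart R n.+1 M -> 'rV[R]_n.+1 -> 'rV[R]_n.+1 -> Prop).

Lemma eq_pw_smooth_curve C gamma gamma' a b : {in `[a, b], gamma' =1 gamma} ->
  pw_smooth_curve_with S C gamma a b -> pw_smooth_curve_with S C gamma' a b.
Proof.
move=> e [ab [s abs H]]; split=> //; exists s => // i si.
apply: eq_smooth_curve (H i si) => t; rewrite in_itv /= => /andP[it ti].
apply: e; rewrite in_itv /=; apply/andP; split.
  by apply: le_trans it; exact: itv_partition_nth_ge (ltnW _) abs.
by apply: (le_trans ti);
    have := itv_partition_nth_le (si : (i.+1 < (size s).+1)%N) abs.
Qed.

(** Induction on the chain: each new segment is parametrized from the parameter [b] where the curve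
    so far ends, and glued there. *)
Lemma causal_chain_curve p q l : causal_chain S tau p q l ->
  exists beta a b s, [/\ piecewise_causal_curve S beta a b s, beta a = p,
    beta b = q & l = null_length tau beta a b s].
Proof.
have step_curve p' q' t : causal_step S p' q' -> exists gamma u,
    [/\ t < u, {within `[t, u], continuous gamma},
        future_causal_curve S gamma t u \/ past_causal_curve S gamma t u,
        gamma t = p' & gamma u = q'].
  case=> [/(future_segment_curve t)|/(future_segment_past_curve t)]
    [gamma [u [tu sm gt gu]]]; exists gamma, u; split=> //;
    try exact: smooth_curve_continuous sm.
  - by left; exact: smooth_curve_pw.
  - by right; exact: smooth_curve_pw.
elim=> {q l} [q /(step_curve _ _ 0)|q r l _ [beta [a [b [s]]]]].
  move=> [gamma [u [u0 gC cg g0 gu]]]; exists gamma, 0, u, [:: u].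
  split=> //; last by rewrite /null_length /variation big_nat1 /= gu g0.
  by split=> //; [exact: itv_partition1|case].
move=> [[ab abs bC bP] ba bb ->] /(step_curve _ _ b).
move=> [gamma [u [bu gC gP gb gu]]].
(* At [t = b] both pieces take the value [q], so [beta'] agrees with [gamma] on all of [[b, u]]. *)
pose beta' t := if t <= b then beta t else gamma t.
have betaL : {in `[a, b], beta' =1 beta}.
  by move=> t; rewrite in_itv /= /beta' => /andP[_ ->].
have betaR : {in `[b, u], beta' =1 gamma}.
  move=> t; rewrite in_itv /= /beta' => /andP[bt _].
  case: leP => // tb; have -> : t = b by apply/eqP; rewrite eq_le tb.
  by rewrite bb gb.
(* The list [a :: s] has [size s + 1] entries, so for these indices the default value, [u] or [b],
   is never reached. *)
have nthL i : (i <= size s)%N ->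
    nth u (a :: rcons s u) i = nth b (a :: s) i.
  move=> si; rewrite -rcons_cons nth_rcons /= ltnS si.
  exact: set_nth_default.
have nthR : nth u (a :: rcons s u) (size s).+1 = u.
  by rewrite /= nth_rcons ltnn eqxx.
have sb : nth b (a :: s) (size s) = b by exact: itv_partition_nth_size.
exists beta', a, u, (rcons s u); split.
- split.
  + exact: lt_trans bu.
  + case: abs => abs /eqP sE; split; last by rewrite last_rcons.
    by rewrite rcons_path abs sE.
  + have -> : `[a, u]%classic = `[a, b]%classic `|` `[b, u]%classic :> set R.
      apply/seteqP; split=> t /=; rewrite !in_itv /=.
        by move=> /andP[at_ tu]; case: (leP t b) => tb; [left|right]; lra.
      by case=> /andP[? ?]; lra.
    apply: withinU_continuous; [exact: interval_closed|exact: interval_closed| |].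
    * apply: (@subspace_eq_continuous _ _ _ (beta : subspace `[a, b] -> M)) bC.
      by move=> t; rewrite inE => /betaL /esym.
    * apply: (@subspace_eq_continuous _ _ _ (gamma : subspace `[b, u] -> M)) gC.
      by move=> t; rewrite inE => /betaR /esym.
  + move=> i; rewrite size_rcons ltnS leq_eqVlt => /predU1P[->|si].
      rewrite nthR nthL// sb.
      by case: gP => gP; [left|right]; exact: eq_pw_smooth_curve gP.
    rewrite !nthL//; last exact: ltnW.
    have sub : {in `[nth b (a :: s) i, nth b (a :: s) i.+1], beta' =1 beta}.
      move=> t; rewrite in_itv /= => /andP[it ti].
      apply: betaL; rewrite in_itv /=; apply/andP; split.
        by apply: le_trans it; exact: itv_partition_nth_ge (ltnW _) abs.
      by apply: (le_trans ti);
    have := itv_partition_nth_le (si : (i.+1 < (size s).+1)%N) abs.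
    by case: (bP i si) => Pi; [left|right]; exact: eq_pw_smooth_curve Pi.
- by rewrite betaL// in_itv /= lexx ltW.
- by rewrite betaR// in_itv /= lexx ltW.
- rewrite /null_length /variation size_rcons [in RHS]big_nat_recr//=; congr (_ + _).
    rewrite !big_nat; apply: eq_bigr => i /andP[_ si].
    have itvs j : (j <= size s)%N -> nth b (a :: s) j \in `[a, b].
      move=> js; rewrite in_itv /=.
      by rewrite (itv_partition_nth_ge _ abs)// (itv_partition_nth_le _ abs).
    have := nthL i.+1 si; have := itvs i.+1 si; rewrite /= => sib ->.
    by rewrite (nthL i (ltnW si)) !betaL ?itvs// ltnW.
  have := nthR; have := nthL _ (leqnn _); rewrite sb /= => -> ->.
  by rewrite betaR ?betaL ?in_itv /= ?lexx ?ltW// gu bb.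
Qed.

Lemma future_segment_lt p q : time_function S tau -> future_segment S p q ->
  tau p < tau q.
Proof.
move=> [_ mono] [gamma [a [b [ab /(smooth_curve_pw ab) sm <- <-]]]].
by apply: (mono _ _ _ sm) => //; rewrite in_itv /= lexx ltW.
Qed.

(** One causal piece may consist of several smooth segments. Since [tau] is monotone along it,
    cutting it at their end points leaves the null length unchanged. *)
Lemma pw_causal_curve_chain beta a b : time_function S tau ->
  future_causal_curve S beta a b \/ past_causal_curve S beta a b ->
  causal_chain S tau (beta a) (beta b) `|tau (beta b) - tau (beta a)|.
Proof.
move=> tauT H.
suff [s [abs s0 sP sE]] : exists s, [/\ itv_partition a b s, (0 < size s)%N,
    forall i, (i < size s)%N -> causal_step S (beta (nth b (a :: s) i))
                                              (beta (nth b (a :: s) i.+1)) &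
    \sum_(0 <= i < size s) `|tau (beta (nth b (a :: s) i.+1)) -
                              tau (beta (nth b (a :: s) i))| =
    `|tau (beta (nth b (a :: s) (size s))) - tau (beta a)|].
  have sb := itv_partition_nth_size b abs.
  rewrite -[in beta b]sb -sE -(prednK s0).
  apply: (causal_chain_sum (x := fun i => beta (nth b (a :: s) i))) => i.
  by rewrite prednK// => si; apply: causal_chain1; exact: sP.
have size_gt0 s : a < b -> itv_partition a b s -> (0 < size s)%N.
  by case: s => // ab /itv_partition_nil abE; rewrite abE ltxx in ab.
have lt_nth s i : itv_partition a b s -> (i < size s)%N ->
    nth b (a :: s) i < nth b (a :: s) i.+1.
  by move=> [/(pathP b) abs _] /abs.
case: H => [][ab [s abs sP]]; exists s; split=> //; try exact: size_gt0 abs.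
- by move=> i si; left; do 3 eexists; split; first exact: lt_nth abs si;
    first exact: sP.
- apply: (sum_dist_nondecreasing (f := fun i => tau (beta (nth b (a :: s) i)))).
  move=> i si; apply/ltW/future_segment_lt => //.
  by do 3 eexists; split; first exact: lt_nth abs si; first exact: sP.
- move=> i si; right; apply: past_curve_future_segment (sP i si).
  exact: lt_nth abs si.
(* On a past piece [tau] decreases, so the telescoping sum is applied to its negative. *)
- have distN (x y : R) : `|- x - - y| = `|x - y| by rewrite opprK addrC distrC.
  have := sum_dist_nondecreasing
    (f := fun i => - tau (beta (nth b (a :: s) i))) (k := size s).
  rewrite distN; under eq_bigr do rewrite distN.
  apply=> i si; rewrite lerN2; apply/ltW/future_segment_lt => //.
  by apply: past_curve_future_segment (sP i si); exact: lt_nth abs si.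
Qed.

(** Curves and chains realize the same set of lengths: a curve is cut into its smooth segments, a
    chain is glued into a curve. *)
Lemma null_distance_chain p q : time_function S tau ->
  null_distance S tau p q = inf [set l | causal_chain S tau p q l].
Proof.
move=> tauT; rewrite /null_distance; congr inf; apply/seteqP; split=> l /=.
  move=> [beta [a [b [s [[ab abs _ bP] <- <- ->]]]]].
  have s0 : (0 < size s)%N.
    by case: s abs {bP} => // /itv_partition_nil abE; rewrite abE ltxx in ab.
  rewrite -[in beta b](itv_partition_nth_size b abs) /null_length /variation.
  rewrite -(prednK s0).
  apply: (causal_chain_sum (x := fun i => beta (nth b (a :: s) i))) => i.
  by rewrite prednK// => si; apply: pw_causal_curve_chain => //; exact: bP.
move=> /causal_chain_curve[beta [a [b [s H]]]].
by exists beta, a, b, s.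
Qed.

End NullDistance.

(** * Comparison with [d], metric axioms and completeness *)

Section Completeness.
Variables (R : realType) (n : nat) (M : topologicalType).
Variables (S : spacetime R n M) (tau : M -> R) (d : M -> M -> R).
Hypotheses (tauT : time_function S tau) (d_metric : is_metric d).
Hypothesis (lip : anti_lipschitz S tau d).
Implicit Types p q r : M.

(** The anti-Lipschitz bound holds for a step in either direction because [d] is symmetric; the
    triangle inequality adds the steps. *)
Lemma dist_le_causal_chain p q l : causal_chain S tau p q l -> d p q <= l.
Proof.
have [d0 _ dC dT] := d_metric.
have step p' q' : causal_step S p' q' -> d p' q' <= `|tau q' - tau p'|.
  case=> /future_segment_le/lip dpq; [|rewrite dC distrC];
    exact: le_trans dpq (ler_norm _).
elim=> {q l} [q /step//|q r l _ IH /step qr].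
exact: le_trans (dT _ q _) (lerD IH qr).
Qed.

Lemma has_inf_causal_chain p q : has_inf [set l | causal_chain S tau p q l].
Proof.
split; first exact: causal_chain_total tauT.1.
by exists (d p q) => l; exact: dist_le_causal_chain.
Qed.

Lemma dist_le_null_distance p q : d p q <= null_distance S tau p q.
Proof.
rewrite null_distance_chain//; apply: lb_le_inf.
  by case: (has_inf_causal_chain p q).
by move=> l; exact: dist_le_causal_chain.
Qed.

Lemma null_distance_le_causal_chain p q l :
  causal_chain S tau p q l -> null_distance S tau p q <= l.
Proof.
move=> pql; rewrite null_distance_chain//.
by apply: ge_inf pql; case: (has_inf_causal_chain p q).
Qed.

Lemma null_distance_adherent p q e : 0 < e ->
  exists2 l, causal_chain S tau p q l & l < null_distance S tau p q + e.
Proof.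
move=> e0; rewrite null_distance_chain//; apply: inf_adherent => //.
exact: has_inf_causal_chain.
Qed.

(** Null-distance balls are neighbourhoods of their centre in M, so convergence in M implies
    convergence for the null distance. *)
Lemma near_null_distance p e : 0 < e ->
  \forall q \near p, null_distance S tau p q < e.
Proof.
move=> e0; apply: filterS (near_causal_chain S p tauT.1 e0) => q [l le pql].
exact: le_lt_trans (null_distance_le_causal_chain pql) le.
Qed.

Lemma null_distance_sym p q : null_distance S tau p q = null_distance S tau q p.
Proof.
rewrite !null_distance_chain//; congr inf.
by apply/seteqP; split=> l /=; exact: causal_chain_sym.
Qed.

Lemma null_distance_metric : is_metric (null_distance S tau).
Proof.
have [d0 dE dC dT] := d_metric.
have nd0 p q : 0 <= null_distance S tau p q.
  exact: le_trans (d0 p q) (dist_le_null_distance p q).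
split=> // [p q||p q r].
- split=> [pq0|<-].
    apply/dE/le_anti; rewrite d0 andbT -pq0.
    exact: dist_le_null_distance.
  (* A chain has at least one step, so no trivial chain gives distance 0 from [p] to itself; instead
     [p] lies in each of its own small neighbourhoods. *)
  apply/le_anti; rewrite nd0 andbT; apply/ler_addgt0Pr => e e0.
  by rewrite add0r ltW//; exact: nbhs_singleton (near_null_distance p e0).
- exact: null_distance_sym.
(* Two chains within [e / 2] of optimal are concatenated. *)
- apply/ler_addgt0Pr => e e0; have e2 : 0 < e / 2 by rewrite divr_gt0.
  have [l pql le] := null_distance_adherent p q e2.
  have [l' qrl le'] := null_distance_adherent q r e2.
  apply: le_trans (null_distance_le_causal_chain (causal_chain_cat pql qrl)) _.
  lra.
Qed.

End Completeness.

Theorem theorem1p6 (R : realType) (n : nat) (M : topologicalType)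
    (S : spacetime R n M) (tau : M -> R) (htau : time_function S tau)
    (d : M -> M -> R) (hd : complete_metric d) (hdtop : induces_topology d)
    (hlip : anti_lipschitz S tau d) :
  complete_metric (null_distance S tau).
Proof.
have [dM dcomplete] := hd; split; first exact: null_distance_metric hlip.
move=> u uC; have [e e0|p up] := dcomplete u.
  have [N uN] := uC e e0; exists N => i j Ni Nj.
  exact: le_lt_trans (dist_le_null_distance htau dM hlip _ _) (uN i j Ni Nj).
exists p => e /(near_null_distance htau dM hlip p).
(* As [d] induces the topology of M, the null-distance ball of radius [e] about [p] contains a
   [d]-ball of some radius [r], which the sequence eventually enters. *)
move=> /hdtop[r /up[N uN] rnear]; exists N => i Ni.
rewrite (null_distance_sym htau); apply: rnear => /=.
by have [_ _ dC _] := dM; rewrite dC; exact: uN.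
Qed.
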